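(* Let $\mathcal{P}$ be a deterministic protocol. If $\mathcal{P}$ tests whether the distributed linear system $Ax=b$ is feasible in the coordinator model, then its communication complexity is $\Omega(sd^2L)$. If $\mathcal{P}$ tests whether $Ax=b$ is feasible in the blackboard model, then its communication complexity is $\Omega(s + d^2L)$.
   Context: There are $s\ge2$ servers $P_1,\dots,P_s$ and a coordinator. $A\in\mathbb{R}^{n\times d}$ and $b\in\mathbb{R}^n$ have integer entries in $[-2^L,2^L]$, and the rows of $[A~b]$ are partitioned among servers ($P_i$ holds $A^{(i)}x=b^{(i)}$). Feasibility testing: the coordinator must report whether $Ax=b$ has a solution. In the coordinator model servers communicate only with the coordinator through private channels; in the blackboard model all messages are broadcast on a shared blackboard whose contents determine who speaks next. Communication complexity is the total number of bits sent. *)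

(* Defs.v *)
From HB Require Import structures.
From mathcomp Require Import all_boot all_order all_algebra.
From mathcomp Require Import reals.

Set Implicit Arguments.
Unset Strict Implicit.
Unset Printing Implicit Defensive.

Import Order.TTheory GRing.Theory Num.Theory.
Local Open Scope ring_scope.

(* [sys_owner k] is the server holding row [k] of [A b].  The partition is part
   of the input: a protocol has to cope with every distribution of the rows. *)
Record dist_system (s n d : nat) := DistSystem {
  sys_mat : 'M[int]_(n, d);
  sys_rhs : 'cV[int]_n;
  sys_owner : 'I_n -> 'I_s
}.

Definition bounded_entries (s n d L : nat) (S : dist_system s n d) : Prop :=
  (forall k j, `|sys_mat S k j| <= 2%:R ^+ L) /\
  (forall k, `|sys_rhs S k 0| <= 2%:R ^+ L).

Definition feasible (R : realType) (s n d : nat) (S : dist_system s n d) : Prop :=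
  exists x : 'cV[R]_d,
    map_mx intr (sys_mat S) *m x = map_mx intr (sys_rhs S).

Definition local_system (d : nat) : Type := seq ('rV[int]_d * int).

Definition local_input (s n d : nat) (S : dist_system s n d) (i : 'I_s) :
    local_system d :=
  [seq (row k (sys_mat S), sys_rhs S k 0) | k <- enum 'I_n & sys_owner S k == i].

(* Deterministic protocols are described bit by bit: each step transmits exactly
   one bit, so the number of steps is the number of bits sent.  [X] is the type
   of the private inputs of the servers; the coordinator has no input. *)

Variant direction := ToServer | FromServer.

Definition channel_log : Type := seq (direction * bool).

Definition coord_log (s : nat) : Type := seq ('I_s * (direction * bool)).

Definition channel (s : nat) (i : 'I_s) (w : coord_log s) : channel_log :=
  [seq e.2 | e <- w & e.1 == i].

Variant coord_action (s : nat) :=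
  | CReport of bool
  | CSend of 'I_s & bool
  | CListen of 'I_s.

(* Channels are private: the coordinator acts on the log of all channels, whereas
   a server only sees its own input and its own channel. *)
Record coord_protocol (s : nat) (X : Type) := CoordProtocol {
  coord_next : coord_log s -> coord_action s;
  coord_server : 'I_s -> X -> channel_log -> bool
}.

Inductive coord_exec (s : nat) (X : Type) (P : coord_protocol s X)
    (x : 'I_s -> X) : coord_log s -> Prop :=
  | CExecStart : coord_exec P x [::]
  | CExecSend w i m :
      coord_exec P x w -> coord_next P w = CSend i m ->
      coord_exec P x (rcons w (i, (ToServer, m)))
  | CExecListen w i :
      coord_exec P x w -> coord_next P w = CListen i ->
      coord_exec P x
        (rcons w (i, (FromServer, coord_server P i (x i) (channel i w)))).

Definition coord_halts (s : nat) (X : Type) (P : coord_protocol s X)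
    (x : 'I_s -> X) (w : coord_log s) (o : bool) : Prop :=
  coord_exec P x w /\ coord_next P w = CReport s o.

(* In [BSpeak p], [p = None] stands for the coordinator and [p = Some i] for
   server [i].  The speaker of every bit is determined by the preceding bits, so
   the board need not record it. *)
Variant board_action (s : nat) :=
  | BReport of bool
  | BSpeak of option 'I_s.

Record board_protocol (s : nat) (X : Type) := BoardProtocol {
  board_next : seq bool -> board_action s;
  board_coord : seq bool -> bool;
  board_server : 'I_s -> X -> seq bool -> bool
}.

Inductive board_exec (s : nat) (X : Type) (P : board_protocol s X)
    (x : 'I_s -> X) : seq bool -> Prop :=
  | BExecStart : board_exec P x [::]
  | BExecCoord w :
      board_exec P x w -> board_next P w = BSpeak None ->
      board_exec P x (rcons w (board_coord P w))
  | BExecServer w i :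
      board_exec P x w -> board_next P w = BSpeak (Some i) ->
      board_exec P x (rcons w (board_server P i (x i) w)).

Definition board_halts (s : nat) (X : Type) (P : board_protocol s X)
    (x : 'I_s -> X) (w : seq bool) (o : bool) : Prop :=
  board_exec P x w /\ board_next P w = BReport s o.

Definition coord_tests_feasibility (R : realType) (s n d L : nat)
    (P : coord_protocol s (local_system d)) : Prop :=
  forall S : dist_system s n d, bounded_entries L S ->
  exists w o, coord_halts P (local_input S) w o /\ (o <-> feasible R S).

Definition board_tests_feasibility (R : realType) (s n d L : nat)
    (P : board_protocol s (local_system d)) : Prop :=
  forall S : dist_system s n d, bounded_entries L S ->
  exists w o, board_halts P (local_input S) w o /\ (o <-> feasible R S).

(* The communication complexity is the largest number of bits sent over all
   admissible inputs; these predicates say that it is at least [B]. *)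
Definition coord_complexity_ge (R : realType) (s n d L : nat)
    (P : coord_protocol s (local_system d)) (B : R) : Prop :=
  exists S : dist_system s n d, bounded_entries L S /\
  exists w o, coord_halts P (local_input S) w o /\ B <= (size w)%:R.

Definition board_complexity_ge (R : realType) (s n d L : nat)
    (P : board_protocol s (local_system d)) (B : R) : Prop :=
  exists S : dist_system s n d, bounded_entries L S /\
  exists w o, board_halts P (local_input S) w o /\ B <= (size w)%:R.

(* Main.v *)
Require Import Defs.
From HB Require Import structures.
From mathcomp Require Import all_boot all_order all_algebra.
From mathcomp Require Import reals boolp.
From mathcomp Require Import zify.

Set Implicit Arguments.
Unset Strict Implicit.
Unset Printing Implicit Defensive.

Import Order.TTheory GRing.Theory Num.Theory.
Local Open Scope ring_scope.

(** Blocks [T_c] of [d] equations that are each solvable but pairwise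
    contradictory form a fooling set: if all servers hold [T_c], the system is
    feasible, and replacing the block of a single server by [T_c'] makes it
    infeasible.  Hence for every server [i] the transcript on channel [i] of the
    run on [(T_c, ..., T_c)] determines [c], and averaging over [c] yields one
    [c] for which a constant fraction of the [s] channels are long at the same
    time.  On the blackboard the whole transcript determines [c], and every
    server must speak.

    A family of [2 ^ Omega(d^2 L)] such blocks comes from base [B = 2 ^ L]:
    about [d / 2] equations force variables [y_k] to be [B ^ (k - m)], and each
    remaining variable is the combination of the [y_k] whose coefficients are
    the digits of an arbitrary integer below [B ^ (m + 1)]. *)

(** * Executions of deterministic protocols *)

(** Both points equal the iterate number [k + l]. Applied to the step maps below, this makes the
    halting transcript of a run unique. *)
Lemma iter_fixpoint_unique (T : Type) (f : T -> T) (a x y : T) (k l : nat) :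
  x = iter k f a -> y = iter l f a -> f x = x -> f y = y -> x = y.
Proof.
move=> xE yE fx fy.
by rewrite -(iter_fix l fx) xE -iterD addnC iterD -yE (iter_fix k fy).
Qed.

Section CoordinatorExecutions.
Variables (s : nat) (X : Type) (P : coord_protocol s X).
Implicit Types (x y : 'I_s -> X) (w : coord_log s) (i : 'I_s).

(** A report leaves the log unchanged, so halting logs are fixed points of this map. *)
Definition coord_step x w : coord_log s :=
  match coord_next P w with
  | CReport _ => w
  | CSend i m => rcons w (i, (ToServer, m))
  | CListen i =>
      rcons w (i, (FromServer, coord_server P i (x i) (channel i w)))
  end.

Lemma coord_exec_iter x w :
  coord_exec P x w -> exists k, w = iter k (coord_step x) [::].
Proof.
elim=> [|{}w i m _ [k wE] nw|{}w i _ [k wE] nw]; first by exists 0.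
- by exists k.+1; rewrite iterS -wE /coord_step nw.
- by exists k.+1; rewrite iterS -wE /coord_step nw.
Qed.

Lemma coord_halts_unique x w w' o o' :
  coord_halts P x w o -> coord_halts P x w' o' -> o = o'.
Proof.
move=> [/coord_exec_iter[k wE] nw] [/coord_exec_iter[l w'E] nw'].
have ww' : w = w'.
  by apply: iter_fixpoint_unique wE w'E _ _; rewrite /coord_step ?nw ?nw'.
by move: nw; rewrite ww' nw' => -[].
Qed.

Definition channel_consistent (f : channel_log -> bool) (l : channel_log) :=
  forall p b q, l = p ++ (FromServer, b) :: q -> b = f p.

Lemma channel_consistent_rcons f l e :
  channel_consistent f (rcons l e) <->
  channel_consistent f l /\ (forall b, e = (FromServer, b) -> b = f l).
Proof.
split=> [ok|[ok oke] p b q].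
  split=> [p b q lE|b eE]; last by apply: (ok l b [::]); rewrite cats1 eE.
  by apply: (ok p b (rcons q e)); rewrite lE rcons_cat.
case/lastP: q => [|q e'].
  by rewrite cats1 => /rcons_inj[<- /oke].
by rewrite -rcons_cons -rcons_cat => /rcons_inj[/ok].
Qed.

Lemma channel_rcons i w e :
  channel i (rcons w e) =
  if e.1 == i then rcons (channel i w) e.2 else channel i w.
Proof.
rewrite /channel filter_rcons; case: ifP => // _; exact: map_rcons.
Qed.

Lemma size_channels w : (\sum_i size (channel i w) = size w)%N.
Proof.
elim/last_ind: w => [|w e IHw]; first by rewrite big1.
rewrite size_rcons -IHw (bigD1 e.1) // [in RHS](bigD1 e.1) //=.
rewrite channel_rcons eqxx size_rcons addSn; congr (_ + _).+1.
by apply: eq_bigr => i ne; rewrite channel_rcons eq_sym (negbTE ne).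
Qed.

Lemma coord_exec_consistent x w i :
  coord_exec P x w ->
  channel_consistent (coord_server P i (x i)) (channel i w).
Proof.
elim=> [p b q|{}w j m _ IHw _|{}w j _ IHw _]; first by case: p.
- rewrite channel_rcons; case: ifP => //= _.
  by apply/channel_consistent_rcons; split.
- rewrite channel_rcons; case: ifP => //= /eqP->.
  by apply/channel_consistent_rcons; split=> // b [].
Qed.

(** The coordinator acts on the log alone, so inputs enter a run only through the bits that each
    server sends on its own channel. *)
Lemma coord_exec_transfer x y w :
  coord_exec P x w ->
  (forall i, channel_consistent (coord_server P i (y i)) (channel i w)) ->
  coord_exec P y w.
Proof.
elim=> [_|{}w j m _ IHw nw ok|{}w j _ IHw nw ok]; first exact: CExecStart.
- apply: CExecSend nw; apply: IHw => i.
  have := ok i; rewrite channel_rcons; case: ifP => // _.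
  by move/channel_consistent_rcons=> [].
- have -> : coord_server P j (x j) (channel j w) =
            coord_server P j (y j) (channel j w).
    have := ok j; rewrite channel_rcons eqxx => /channel_consistent_rcons[_].
    exact.
  apply: CExecListen nw; apply: IHw => i.
  have := ok i; rewrite channel_rcons; case: ifP => // _.
  by move/channel_consistent_rcons=> [].
Qed.

(** A rectangle property for a single channel: server [i] sees only its input and channel [i], so
    the two runs may differ on all other channels. *)
Lemma coord_exec_cut x x' y w w' i :
  coord_exec P x w -> coord_exec P x' w' -> channel i w = channel i w' ->
  y i = x' i -> (forall j, j != i -> y j = x j) -> coord_exec P y w.
Proof.
move=> xw xw' ww' yi yN; apply: coord_exec_transfer (xw) _ => j.
have [->|/yN->] := eqVneq j i; last exact: coord_exec_consistent xw.
by rewrite yi ww'; apply: coord_exec_consistent xw'.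
Qed.

End CoordinatorExecutions.

Section BoardExecutions.
Variables (s : nat) (X : Type) (P : board_protocol s X).
Implicit Types (x y : 'I_s -> X) (w : seq bool) (i : 'I_s).

Definition board_step x w : seq bool :=
  match board_next P w with
  | BReport _ => w
  | BSpeak None => rcons w (board_coord P w)
  | BSpeak (Some i) => rcons w (board_server P i (x i) w)
  end.

Lemma board_exec_iter x w :
  board_exec P x w -> exists k, w = iter k (board_step x) [::].
Proof.
elim=> [|{}w _ [k wE] nw|{}w i _ [k wE] nw]; first by exists 0.
- by exists k.+1; rewrite iterS -wE /board_step nw.
- by exists k.+1; rewrite iterS -wE /board_step nw.
Qed.

Lemma board_halts_unique x w w' o o' :
  board_halts P x w o -> board_halts P x w' o' -> o = o'.
Proof.
move=> [/board_exec_iter[k wE] nw] [/board_exec_iter[l w'E] nw'].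
have ww' : w = w'.
  by apply: iter_fixpoint_unique wE w'E _ _; rewrite /board_step ?nw ?nw'.
by move: nw; rewrite ww' nw' => -[].
Qed.

(** The board does not record speakers, so the condition runs over positions and asks [board_next]
    who spoke there. *)
Definition board_consistent x w i :=
  forall j, (j < size w)%N -> board_next P (take j w) = BSpeak (Some i) ->
  nth false w j = board_server P i (x i) (take j w).

Lemma board_consistent_rcons x w b i :
  board_consistent x (rcons w b) i <->
  board_consistent x w i /\
  (board_next P w = BSpeak (Some i) -> b = board_server P i (x i) w).
Proof.
split=> [ok|[ok okb] j].
  split=> [j jw|nw].
    have := ok j; rewrite size_rcons ltnS (ltnW jw) nth_rcons jw -cats1.
    by rewrite takel_cat ?(ltnW jw) //; apply.
  have := ok (size w); rewrite size_rcons ltnSn nth_rcons ltnn eqxx -cats1.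
  by rewrite takel_cat // take_size; apply.
rewrite size_rcons ltnS => jw; rewrite nth_rcons -cats1 takel_cat //.
move: jw; rewrite leq_eqVlt => /predU1P[->|jw]; last by rewrite jw; apply: ok.
by rewrite take_size ltnn eqxx.
Qed.

Lemma board_exec_consistent x w i :
  board_exec P x w -> board_consistent x w i.
Proof.
elim=> [j //|{}w _ IHw nw|{}w j _ IHw nw].
- by apply/board_consistent_rcons; rewrite nw.
- by apply/board_consistent_rcons; split=> //; rewrite nw => -[->].
Qed.

Lemma board_exec_transfer x y w :
  board_exec P x w -> (forall i, board_consistent y w i) -> board_exec P y w.
Proof.
elim=> [_|{}w _ IHw nw ok|{}w j _ IHw nw ok]; first exact: BExecStart.
- apply: BExecCoord nw; apply: IHw => i.
  by have /board_consistent_rcons[] := ok i.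
- have /board_consistent_rcons[_ /(_ nw)->] := ok j.
  apply: BExecServer nw; apply: IHw => i.
  by have /board_consistent_rcons[] := ok i.
Qed.

Lemma board_consistent_eq x y w i :
  x i = y i -> board_consistent x w i -> board_consistent y w i.
Proof. by rewrite /board_consistent => ->. Qed.

(** A server reads the whole board, so here the two runs share the entire transcript. *)
Lemma board_exec_cut x x' y w i :
  board_exec P x w -> board_exec P x' w ->
  y i = x' i -> (forall j, j != i -> y j = x j) -> board_exec P y w.
Proof.
move=> xw xw' yi yN; apply: board_exec_transfer (xw) _ => j.
have [->|/yN yj] := eqVneq j i.
  exact: board_consistent_eq (esym yi) (board_exec_consistent xw').
exact: board_consistent_eq (esym yj) (board_exec_consistent xw).
Qed.

(** The consistency condition of a server that never speaks is vacuous, so its input can be changed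
    freely. *)
Lemma board_exec_silent x y w i :
  board_exec P x w ->
  (forall j, (j < size w)%N -> board_next P (take j w) <> BSpeak (Some i)) ->
  (forall j, j != i -> y j = x j) -> board_exec P y w.
Proof.
move=> xw silent yN; apply: board_exec_transfer (xw) _ => j.
have [->|/yN yj] := eqVneq j i; first by move=> k /silent.
exact: board_consistent_eq (esym yj) (board_exec_consistent xw).
Qed.

End BoardExecutions.

(** * Distributing one block of rows to each server *)

Section Blocks.
Variables (s n d : nat).

Definition block : Type := ('M[int]_d * 'cV[int]_d)%type.

Definition solves (R : realType) (T : block) (x : 'cV[R]_d) : Prop :=
  map_mx intr T.1 *m x = map_mx intr T.2.

Definition block_bounded (L : nat) (T : block) : Prop :=
  (forall r j, `|T.1 r j| <= 2%:R ^+ L) /\ (forall r, `|T.2 r 0| <= 2%:R ^+ L).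

(* Rows with index at least [s * d] duplicate rows of server [i0]. *)
Definition join_blocks (i0 : 'I_s) (r0 : 'I_d) (T : 'I_s -> block) :
    dist_system s n d :=
  let own (k : 'I_n) := insubd i0 (k %/ d)%N in
  let pos (k : 'I_n) := insubd r0 (k %% d)%N in
  DistSystem (\matrix_(k, j) (T (own k)).1 (pos k) j)
             (\col_k (T (own k)).2 (pos k) 0) own.

Variables (i0 : 'I_s) (r0 : 'I_d).
Implicit Types T : 'I_s -> block.

Lemma join_blocks_bounded (L : nat) T :
  (forall i, block_bounded L (T i)) ->
  bounded_entries L (join_blocks i0 r0 T).
Proof.
move=> bT; split=> [k j|k]; rewrite mxE.
- exact: (bT _).1.
- exact: (bT _).2.
Qed.

(** Ownership does not depend on [T], and the rows owned by [i] carry entries of [T i] only. *)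
Lemma local_input_join_eq T T' i :
  T i = T' i ->
  local_input (join_blocks i0 r0 T) i = local_input (join_blocks i0 r0 T') i.
Proof.
move=> TT'; apply/eq_in_map => k; rewrite mem_filter => /andP[/eqP /= ownk _].
congr (_, _); last by rewrite !mxE ownk TT'.
by apply/rowP => j; rewrite !mxE ownk TT'.
Qed.

Lemma feasible_join (R : realType) T :
  (s * d <= n)%N ->
  feasible R (join_blocks i0 r0 T) <->
  exists x : 'cV[R]_d, forall i, solves (T i) x.
Proof.
move=> sdn; split=> -[x xP]; exists x; last first.
  apply/colP => k; have /colP := xP (insubd i0 (k %/ d)%N).
  move/(_ (insubd r0 (k %% d)%N)); rewrite !mxE => <-.
  by apply: eq_bigr => j _; rewrite !mxE.
move=> i; apply/colP => r.
(* Row [r] of block [i] has index [i * d + r], which is below [s * d]. *)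
have kn : (i * d + r < n)%N.
  by apply: leq_trans sdn; have := ltn_ord i; have := ltn_ord r; nia.
have /colP/(_ (Ordinal kn)) := xP.
have d0 : (0 < d)%N by apply: leq_ltn_trans (ltn_ord r).
rewrite !mxE /= divnMDl // divn_small // addn0 valKd modnMDl modn_small //.
rewrite valKd => <-.
by apply: eq_bigr => j _; rewrite !mxE /= divnMDl // divn_small // addn0 valKd
  modnMDl modn_small // valKd.
Qed.

End Blocks.

(** * Large families of pairwise contradictory blocks *)

Lemma base_expansion (B n u : nat) : (0 < B)%N -> (u < B ^ n)%N ->
  (\sum_(k < n) (u %/ B ^ k %% B) * B ^ k)%N = u.
Proof.
move=> B0; elim: n u => [|n IHn] u; first by rewrite big_ord0 ltnS leqn0 => /eqP.
rewrite expnS => uB; rewrite big_ord_recl /= expn0 divn1 muln1.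
rewrite [RHS](divn_eq u B) addnC; congr (_ + _)%N.
rewrite -[in RHS](IHn (u %/ B)%N); last by rewrite ltn_divLR // mulnC.
rewrite big_distrl /=; apply: eq_bigr => k _.
by rewrite /bump /= add1n expnS divnMA mulnA mulnAC.
Qed.

Section DigitBlocks.
Variables (m e B : nat).
Hypothesis B_gt0 : (0 < B)%N.

Definition digit (u k : nat) : nat := (u %/ B ^ k %% B)%N.

(* On a vector [(y, z)] the rows say that [y_(r+1) = B * y_r], where [y_m] is the
   constant [1], and that [z_i] is the sum of the [digit (u i) k * y_k]. *)
Definition digit_block (u : 'I_e -> nat) : block (m + e) :=
  (block_mx (\matrix_(r, j) (B%:R *+ (j == r) - (j == r.+1 :> nat)%:R)) 0
            (\matrix_(i, j) - (digit (u i) j)%:R) 1%:M,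
   col_mx (\col_r (r.+1 == m)%:R) (\col_i (digit (u i) m)%:R)).

(** Index [m] lies outside ['I_m] and yields the default [1], the constant that stands for [y_m]. *)
Definition pad (R : realType) (y : 'cV[R]_m) (k : nat) : R :=
  oapp (fun j => y j 0) 1 (insub k).

Lemma pad_ord (R : realType) (y : 'cV[R]_m) (j : 'I_m) : pad y j = y j 0.
Proof. by rewrite /pad valK. Qed.

Lemma pad_m (R : realType) (y : 'cV[R]_m) : pad y m = 1.
Proof. by rewrite /pad insubN // ltnn. Qed.

Lemma solves_digit_block (R : realType) (u : 'I_e -> nat)
    (y : 'cV[R]_m) (z : 'cV[R]_e) :
  solves (digit_block u) (col_mx y z) <->
  (forall r : 'I_m, pad y r.+1 = B%:R * pad y r) /\
  (forall i, z i 0 = \sum_(k < m.+1) (digit (u i) k)%:R * pad y k).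
Proof.
rewrite /solves /= map_block_mx map_col_mx mul_block_col.
rewrite map_mx0 mul0mx addr0 map_mx1 mul1mx.
have topE (r : 'I_m) :
    (map_mx intr (\matrix_(r, j) (B%:R *+ (j == r) - (j == r.+1 :> nat)%:R))
       *m y) r 0 - ((r.+1 == m)%:R : int)%:~R = B%:R * pad y r - pad y r.+1.
  rewrite !mxE (eq_bigr (fun j : 'I_m => (if j == r then B%:R * y j 0 else 0) +
    (if j == r.+1 :> nat then - y j 0 else 0))); last first.
    move=> j _; rewrite !mxE rmorphB rmorphMn /= !rmorph_nat mulrBl.
    congr (_ + _); first by case: eqP; rewrite ?mul0r.
    by case: eqP; rewrite ?mul0r ?mul1r ?oppr0.
  rewrite big_split /= -!big_mkcond /= big_pred1_eq pad_ord -addrA.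
  (* If [r + 1 < m], column [r + 1] supplies [y_(r+1)] and the right-hand side is [0]; if
     [r + 1 = m], that column is missing and the right-hand side [1] supplies [y_m]. *)
  congr (_ + _); have [rm|rm] := ltnP r.+1 m.
    rewrite (big_pred1 (Ordinal rm)) // ltn_eqF // subr0.
    by rewrite -(pad_ord y (Ordinal rm)).
  have /eqP rmE : r.+1 == m by rewrite eqn_leq rm ltn_ord.
  rewrite big1 ?add0r; last by move=> j /eqP jE; have := ltn_ord j; lia.
  by rewrite rmE eqxx pad_m.
have botE (i : 'I_e) :
    (map_mx intr (\matrix_(i, j) - (digit (u i) j)%:R : 'M[int]_(e, m)) *m y)
      i 0 - ((digit (u i) m)%:R : int)%:~R
    = - \sum_(k < m.+1) (digit (u i) k)%:R * pad y k.
  rewrite big_ord_recr /= pad_m mulr1 rmorph_nat opprD; congr (_ - _).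
  rewrite mxE -sumrN; apply: eq_bigr => j _.
  by rewrite !mxE rmorphN rmorph_nat mulNr pad_ord.
split=> [/eq_col_mx[/colP top /colP bot]|[top bot]].
  split=> [r|i].
    by apply/eqP; rewrite eq_sym -subr_eq0 -topE top !mxE subrr.
  have := bot i; rewrite [LHS]mxE => botz.
  by apply/eqP; rewrite -subr_eq0 -botE addrA (addrC (z i 0)) botz !mxE subrr.
congr col_mx; apply/colP => i.
  apply/eqP; rewrite -subr_eq0 [X in _ - X]mxE [X in _ - X%:~R]mxE.
  by rewrite topE top subrr.
apply/eqP; rewrite -subr_eq0 [X in _ - X]mxE [X in _ - X%:~R]mxE.
by rewrite [X in X - _]mxE addrAC botE bot addNr.
Qed.

(** This is the base [B] expansion of [v] scaled by [B ^ (-m)]. The [m] variables and the constant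
    leave room for [m + 1] digits. *)
Lemma digit_combination (R : realType) (y : 'cV[R]_m) (v : nat) :
  (forall k, (k <= m)%N -> pad y k = B%:R ^+ k / B%:R ^+ m) ->
  (v < B ^ m.+1)%N ->
  \sum_(k < m.+1) (digit v k)%:R * pad y k = v%:R / B%:R ^+ m.
Proof.
move=> yE vB; rewrite -[in RHS](base_expansion B_gt0 vB) natr_sum mulr_suml.
apply: eq_bigr => k _; rewrite yE; last by rewrite -ltnS.
by rewrite natrM natrX mulrA.
Qed.

Lemma digit_block_solvable (R : realType) (u : 'I_e -> nat) :
  exists x : 'cV[R]_(m + e), solves (digit_block u) x.
Proof.
pose y : 'cV[R]_m := \col_j (B%:R ^+ j / B%:R ^+ m).
have B0 : B%:R != 0 :> R by rewrite pnatr_eq0 -lt0n.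
have yE k : (k <= m)%N -> pad y k = B%:R ^+ k / B%:R ^+ m.
  rewrite leq_eqVlt => /predU1P[->|km]; first by rewrite pad_m divff ?expf_neq0.
  by rewrite (pad_ord y (Ordinal km)) mxE.
exists (col_mx y (\col_i \sum_(k < m.+1) (digit (u i) k)%:R * pad y k)).
apply/solves_digit_block; split=> [r|i]; last by rewrite mxE.
by rewrite !yE ?(ltnW (ltn_ord r)) // exprS mulrA.
Qed.

(** The rows on [y] are the same for all [u] and determine [y]; then [z_i = u_i / B ^ m], so a
    common solution recovers [u]. *)
Lemma digit_block_disjoint (R : realType) (u v : 'I_e -> nat)
    (x : 'cV[R]_(m + e)) :
  (forall i, (u i < B ^ m.+1)%N) -> (forall i, (v i < B ^ m.+1)%N) ->
  solves (digit_block u) x -> solves (digit_block v) x -> u =1 v.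
Proof.
move=> uB vB; rewrite -[x]vsubmxK; set y := usubmx x; set z := dsubmx x.
move=> /solves_digit_block[yS uz] /solves_digit_block[_ vz] i.
have B0 : B%:R != 0 :> R by rewrite pnatr_eq0 -lt0n.
have y0 k : (k <= m)%N -> pad y k = B%:R ^+ k * pad y 0.
  elim: k => [|k IHk] km; first by rewrite mul1r.
  by rewrite (yS (Ordinal km)) IHk ?(ltnW km) // exprS mulrA.
have yE k : (k <= m)%N -> pad y k = B%:R ^+ k / B%:R ^+ m.
  (* The end condition [pad y m = 1] fixes the remaining unknown [pad y 0] as [B ^ (-m)]. *)
  move=> km; rewrite y0 //; congr (_ * _); apply: (mulfI (expf_neq0 m B0)).
  by rewrite -y0 // pad_m divff ?expf_neq0.
have := uz i; rewrite vz !digit_combination // => /(mulIf _) uv.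
by apply/eqP; rewrite eq_sym -(eqr_nat R) uv // invr_eq0 expf_neq0.
Qed.

Lemma digit_block_bounded (L : nat) (u : 'I_e -> nat) :
  B = (2 ^ L)%N -> block_bounded L (digit_block u).
Proof.
move=> BE; rewrite /block_bounded /digit_block.
have -> : 2%:R ^+ L = B%:R :> int by rewrite BE natrX.
have bB (b : bool) : `|b%:R : int| <= B%:R by case: b; rewrite ?normr0 ?normr1 ?ler1n.
have digitB v k : `|(digit v k)%:R : int| <= B%:R.
  by rewrite ger0_norm ?ler0n // ler_nat ltnW // ltn_pmod.
split=> [r j|r] /=.
  rewrite mxE; case: (split r) => r'; rewrite mxE; case: (split j) => j'; rewrite !mxE.
  (* Diagonal and superdiagonal do not meet, so [B] and [-1] never add up in one entry. *)
  - case: (j' =P r') => [->|_]; first by rewrite ltn_eqF // subr0 mulr1n ger0_norm.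
    by rewrite mulr0n sub0r normrN.
  - by rewrite normr0.
  - by rewrite normrN.
  - exact: bB.
by rewrite mxE; case: (split r) => r'; rewrite mxE.
Qed.

End DigitBlocks.

(** There are [e] integers of [m + 1] free digits with [L] bits each, so [M = L * (m + 1) * e]; the
    even split [d = m + e] gives [d ^ 2 <= 4 * (m + 1) * e]. *)
Lemma disjoint_blocks_exist (R : realType) (d L : nat) : (0 < d)%N ->
  exists (F : finType) (M : nat) (T : F -> block d),
  [/\ #|F| = (2 ^ M)%N, (d ^ 2 * L <= 4 * M)%N,
      forall c, block_bounded L (T c),
      forall c, exists x : 'cV[R]_d, solves (T c) x
    & forall c c' (x : 'cV[R]_d), solves (T c) x -> solves (T c') x -> c = c'].
Proof.
move=> d0; pose m := d./2; pose e := uphalf d.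
have dE : d = (m + e)%N by rewrite /m /e uphalf_half addnCA addnn odd_double_half.
have meq : (e = m \/ e = m.+1)%N.
  by rewrite /e uphalf_half; case: (odd d); [right | left].
move: m e dE meq {d0} => m e -> me.
pose B := (2 ^ L)%N; have B0 : (0 < B)%N by rewrite expn_gt0.
pose F : finType := {ffun 'I_e -> 'I_(B ^ m.+1)}.
exists F, (L * m.+1 * e)%N.
exists (fun c : F => digit_block m B (fun i => c i)); split.
- by rewrite card_ffun !card_ord /B !expnM.
- by case: me => ->; nia.
- by move=> c; apply: digit_block_bounded.
- by move=> c; apply: digit_block_solvable.
- move=> c c' x cx c'x; apply/ffunP => i; apply/val_inj.
  exact: (digit_block_disjoint B0 _ _ cx c'x).
Qed.

(** * Counting transcripts *)

(** Padding with [None] turns short sequences injectively into [k]-tuples over [option A]. *)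
Lemma card_short_le (F A : finType) (f : F -> seq A) (k : nat) : injective f ->
  (#|[set c | (size (f c) <= k)%N]| <= #|A|.+1 ^ k)%N.
Proof.
move=> f_inj; rewrite -card_option -card_tuple.
pose g c : k.-tuple (option A) := [tuple onth (f c) j | j < k].
rewrite -(card_in_imset (f := g)) ?max_card // => c c'.
rewrite !inE => ck c'k /(congr1 (@tnth _ _)) gg; apply: f_inj.
apply/eq_from_onth => j; have [jk|kj] := ltnP j k.
  by have /(congr1 (@^~ (Ordinal jk))) := gg; rewrite !tnth_mktuple.
by rewrite !onth_default ?(leq_trans _ kj).
Qed.

Lemma half_long (F A : finType) (f : F -> seq A) (M q : nat) :
  injective f -> #|F| = (2 ^ M)%N -> (0 < q)%N -> (#|A| < 2 ^ q)%N ->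
  (#|F| <= 2 * #|[set c | (M <= q * size (f c))%N]|)%N.
Proof.
move=> f_inj FE q0 Aq; set D := [set c | _].
case: (posnP M) => [M0|M0].
  have -> : D = setT by apply/setP => c; rewrite !inE M0.
  by rewrite cardsT mul2n -addnn leq_addr.
(* The largest length with [q * k < M]: at most [2 ^ (q * k) <= 2 ^ (M - 1)] sequences, half of [F],
   are this short. *)
pose k := (M.-1 %/ q)%N.
have CD : (#|~: D| <= 2 ^ M.-1)%N.
  apply: (@leq_trans (#|A|.+1 ^ k)).
    apply: leq_trans (card_short_le k f_inj).
    apply/subset_leq_card/subsetP => c; rewrite !inE -ltnNge => cM.
    by rewrite /k leq_divRL // mulnC; lia.
  apply: (@leq_trans ((2 ^ q) ^ k)); first by case: (k) => // k'; rewrite leq_exp2r.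
  by rewrite -expnM leq_exp2l // mulnC leq_trunc_div.
have ME : (2 ^ M = 2 * 2 ^ M.-1)%N by rewrite -expnS prednK.
by have := cardsC D; rewrite FE ME; lia.
Qed.

(** The long half may differ from server to server; exchanging the sums over [c] and [i] finds one
    [c] that is good on average over the servers. *)
Lemma sum_large_of_half_large (F : finType) (s M q : nat) (g : 'I_s -> F -> nat) :
  (0 < #|F|)%N ->
  (forall i, #|F| <= 2 * #|[set c | (M <= q * g i c)%N]|)%N ->
  exists c, (s * M <= 2 * q * \sum_i g i c)%N.
Proof.
move=> F0 half; apply/existsP; apply: contraT => /existsPn small.
have: (\sum_(c : F) (2 * q * \sum_i g i c).+1 <= \sum_(c : F) s * M)%N.
  by apply: leq_sum => c _; rewrite ltnNge; apply: small.
rewrite sum_nat_const leqNgt => /negP[].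
(* As [F] is nonempty, the strict inequalities for single [c] add up to a strict one. *)
apply: (@leq_trans (\sum_(c : F) 2 * q * \sum_i g i c).+1); last first.
  under [X in (_ <= X)%N]eq_bigr do rewrite -addn1.
  by rewrite big_split /= sum_nat_const muln1 -addn1 leq_add2l.
rewrite ltnS -big_distrr /= exchange_big /= mulnCA.
rewrite -[X in (X * _ <= _)%N](card_ord s) -(sum_nat_const 'I_s) -mulnA.
rewrite !big_distrr /=; apply: leq_sum => i _.
apply: leq_trans (leq_mul (half i) (leqnn M)) _.
rewrite -mulnA leq_mul2l /= big_distrr /= -sum_nat_const.
(* Each [c] in the long half contributes at least [M]; the others are dropped. *)
rewrite [X in (_ <= X)%N](bigID (mem [set c | (M <= q * g i c)%N])) /=.
by apply: leq_trans (leq_addr _ _); apply: leq_sum => c; rewrite inE.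
Qed.

(** * The lower bounds *)

(** Counting needs a finite alphabet, here one of four letters. *)
Definition entry_code (e : direction * bool) : bool * bool :=
  (if e.1 is ToServer then true else false, e.2).

Lemma entry_code_inj : injective entry_code.
Proof. by move=> [[] b] [[] b'] // [->]. Qed.

Section LowerBounds.
Variables (R : realType) (s n d L : nat).
Hypotheses (s_gt1 : (2 <= s)%N) (d_gt0 : (0 < d)%N) (sdn : (s * d <= n)%N).

Let i0 : 'I_s := Ordinal (ltnW s_gt1).
Let r0 : 'I_d := Ordinal d_gt0.
Notation join := (@join_blocks s n d i0 r0).

Definition swap_at (T T' : block d) (i j : 'I_s) : block d :=
  if j == i then T' else T.

(** Since [s >= 2], a server other than [i] still holds [T]. *)
Lemma swap_at_infeasible (T T' : block d) i :
  (forall x : 'cV[R]_d, solves T x -> solves T' x -> False) ->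
  ~ feasible R (join (swap_at T T' i)).
Proof.
move=> TT' /feasible_join - /(_ sdn)[x xP].
have [j ji] : exists j, j != i.
  have [iE|iN] := eqVneq i i0; last by exists i0; rewrite eq_sym.
  by exists (Ordinal s_gt1); rewrite iE.
apply: (TT' x); last by have := xP i; rewrite /swap_at eqxx.
by have := xP j; rewrite /swap_at (negbTE ji).
Qed.

Lemma local_input_swap_at (T T' : block d) i :
  local_input (join (swap_at T T' i)) i = local_input (join (fun=> T')) i /\
  forall j, j != i ->
  local_input (join (swap_at T T' i)) j = local_input (join (fun=> T)) j.
Proof.
split=> [|j /negbTE ji]; apply: local_input_join_eq; rewrite /swap_at ?eqxx //.
by rewrite ji.
Qed.

Lemma swap_at_bounded (T T' : block d) i :
  block_bounded L T -> block_bounded L T' ->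
  bounded_entries L (join (swap_at T T' i)).
Proof.
by move=> bT bT'; apply: join_blocks_bounded => j; rewrite /swap_at; case: ifP.
Qed.

Lemma const_feasible (T : block d) :
  (exists x : 'cV[R]_d, solves T x) -> feasible R (join (fun=> T)).
Proof. by move=> [x Tx]; apply/feasible_join => //; exists x. Qed.

(* Two inputs with the same transcript on channel [i] cannot be told apart by
   swapping the input of server [i]. *)
Lemma coord_channel_separates (P : coord_protocol s (local_system d))
    (T T' : block d) i w w' o o' :
  coord_tests_feasibility R n L P ->
  block_bounded L T -> block_bounded L T' ->
  (exists x : 'cV[R]_d, solves T x) ->
  (forall x : 'cV[R]_d, solves T x -> solves T' x -> False) ->
  coord_halts P (local_input (join (fun=> T))) w o ->
  coord_halts P (local_input (join (fun=> T'))) w' o' ->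
  channel i w <> channel i w'.
Proof.
move=> test bT bT' fT TT' hw hw' ww'.
have [yi yN] := local_input_swap_at T T' i.
have hy : coord_halts P (local_input (join (swap_at T T' i))) w o.
  split; last exact: hw.2.
  exact: coord_exec_cut hw.1 hw'.1 ww' yi yN.
have [v [p [hv pE]]] := test _ (swap_at_bounded i bT bT').
apply: (swap_at_infeasible (i := i) TT'); apply/pE.
rewrite -(coord_halts_unique hy hv).
have [v' [p' [hv' p'E]]] := test _ (join_blocks_bounded n i0 r0 (fun=> bT)).
by rewrite (coord_halts_unique hw hv'); apply/p'E/const_feasible.
Qed.

(** A common transcript would also be the run in which [i0] alone holds [T'], so an infeasible input
    would get the report of a feasible one. *)
Lemma board_transcript_separates (P : board_protocol s (local_system d))
    (T T' : block d) w o o' :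
  board_tests_feasibility R n L P ->
  block_bounded L T -> block_bounded L T' ->
  (exists x : 'cV[R]_d, solves T x) ->
  (forall x : 'cV[R]_d, solves T x -> solves T' x -> False) ->
  board_halts P (local_input (join (fun=> T))) w o ->
  board_halts P (local_input (join (fun=> T'))) w o' -> False.
Proof.
move=> test bT bT' fT TT' hw hw'.
have [yi yN] := local_input_swap_at T T' i0.
have hy : board_halts P (local_input (join (swap_at T T' i0))) w o.
  split; last exact: hw.2.
  exact: board_exec_cut hw.1 hw'.1 yi yN.
have [v [p [hv pE]]] := test _ (swap_at_bounded i0 bT bT').
apply: (swap_at_infeasible (i := i0) TT'); apply/pE.
rewrite -(board_halts_unique hy hv).
have [v' [p' [hv' p'E]]] := test _ (join_blocks_bounded n i0 r0 (fun=> bT)).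
by rewrite (board_halts_unique hw hv'); apply/p'E/const_feasible.
Qed.

Lemma coord_lower_bound (P : coord_protocol s (local_system d)) :
  coord_tests_feasibility R n L P ->
  exists S : dist_system s n d, bounded_entries L S /\
  exists w o, coord_halts P (local_input S) w o /\
    (s * d ^ 2 * L <= 24 * size w)%N.
Proof.
move=> test.
have [F [M [T [FE dLM bT fT disjT]]]] := disjoint_blocks_exist R L d_gt0.
have /choice[w wP] (c : F) : exists w : coord_log s,
    exists o, coord_halts P (local_input (join (fun=> T c))) w o.
  have [v [o [hv _]]] := test _ (join_blocks_bounded n i0 r0 (fun=> bT c)).
  by exists v, o.
pose log i c := map entry_code (channel i (w c)).
have log_inj i : injective (log i).
  move=> c c' /(inj_map entry_code_inj) cc'; apply/eqP/negPn/negP => /eqP ne.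
  have [[o ho] [o' ho']] := (wP c, wP c').
  apply: (coord_channel_separates test (bT c) (bT c') (fT c) _ ho ho' cc').
  by move=> x cx /(disjT _ _ _ cx).
(* Four letters and the padding symbol fit into [q = 3] bits; with the factor [2] from averaging and
   [4] from the family this gives [24]. *)
have [|i|c cP] := @sum_large_of_half_large F s M 3 (fun i c => size (log i c)).
- by rewrite FE expn_gt0.
- by apply: half_long => //; rewrite card_prod card_bool.
have [o ho] := wP c.
exists (join (fun=> T c)); split; first exact: join_blocks_bounded.
exists (w c), o; split=> //.
move: cP; under eq_bigr do rewrite size_map.
rewrite size_channels -mulnA => cP.
by have := leq_mul (leqnn s) dLM; lia.
Qed.

Lemma board_lower_bound_family (P : board_protocol s (local_system d)) :
  board_tests_feasibility R n L P ->
  exists S : dist_system s n d, bounded_entries L S /\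
  exists w o, board_halts P (local_input S) w o /\
    (d ^ 2 * L <= 8 * size w)%N.
Proof.
move=> test.
have [F [M [T [FE dLM bT fT disjT]]]] := disjoint_blocks_exist R L d_gt0.
have /choice[w wP] (c : F) : exists w : seq bool,
    exists o, board_halts P (local_input (join (fun=> T c))) w o.
  have [v [o [hv _]]] := test _ (join_blocks_bounded n i0 r0 (fun=> bT c)).
  by exists v, o.
have w_inj : injective w.
  move=> c c' cc'; apply/eqP/negPn/negP => /eqP ne.
  have [[o ho] [o' ho']] := (wP c, wP c'); rewrite -cc' in ho'.
  apply: (board_transcript_separates test (bT c) (bT c') (fT c) _ ho ho').
  by move=> x cx /(disjT _ _ _ cx).
(* One long transcript suffices here. With two letters [q = 2] works, which together with the factor
   [4] of the family gives [8]. *)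
have /card_gt0P[c] : (0 < #|[set c | (M <= 2 * size (w c))%N]|)%N.
  have F0 : (0 < #|F|)%N by rewrite FE expn_gt0.
  have /(leq_trans F0) : (#|F| <= 2 * #|[set c | (M <= 2 * size (w c))%N]|)%N.
    by apply: half_long => //; rewrite card_bool.
  by rewrite muln_gt0.
rewrite inE => cP; have [o ho] := wP c.
exists (join (fun=> T c)); split; first exact: join_blocks_bounded.
by exists (w c), o; split=> //; lia.
Qed.

(* A server that stays silent could hold the contradictory rows [0 x = 1]. *)
Lemma board_lower_bound_servers (P : board_protocol s (local_system d)) :
  board_tests_feasibility R n L P ->
  exists S : dist_system s n d, bounded_entries L S /\
  exists w o, board_halts P (local_input S) w o /\ (s <= size w)%N.
Proof.
move=> test; pose T : block d := (0, 0); pose T' : block d := (0, const_mx 1).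
have bT : block_bounded L T.
  by split=> *; rewrite mxE normr0 exprn_ge0.
have bT' : block_bounded L T'.
  by split=> *; rewrite mxE ?normr0 ?normr1 ?exprn_ge0 ?exprn_ege1.
have fT : exists x : 'cV[R]_d, solves T x.
  by exists 0; rewrite /solves mulmx0 map_mx0.
have TT' (x : 'cV[R]_d) : solves T x -> solves T' x -> False.
  move=> _ /colP/(_ r0); rewrite map_mx0 mul0mx !mxE => /esym/eqP.
  by rewrite oner_eq0.
have [w [o [hw oE]]] := test _ (join_blocks_bounded n i0 r0 (fun=> bT)).
exists (join (fun=> T)); split; first exact: join_blocks_bounded.
exists w, o; split=> //.
have speaks i : exists j : 'I_(size w), board_next P (take j w) = BSpeak (Some i).
  apply: contrapT => silent.
  have [yi yN] := local_input_swap_at T T' i.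
  have hy : board_halts P (local_input (join (swap_at T T' i))) w o.
    split; last exact: hw.2.
    apply: board_exec_silent hw.1 _ yN => j jw nj.
    by apply: silent; exists (Ordinal jw).
  have [v [p [hv pE]]] := test _ (swap_at_bounded i bT bT').
  apply: (swap_at_infeasible (i := i) TT'); apply/pE.
  by rewrite -(board_halts_unique hy hv); apply/oE/const_feasible.
(* The preceding bits determine the speaker, so distinct servers speak at distinct positions. *)
have [f fP] := choice speaks.
rewrite -[s]card_ord -[size w]card_ord; apply: (@leq_card _ _ f) => i j fij.
by have := fP i; rewrite fij fP => -[].
Qed.

End LowerBounds.

(* The bounds do not mention n and fail for small n: sending all rows costs only
   O(s + n * d * (L + 1)) bits.  Every n with room for d rows per server is
   covered; a protocol correct for all n is in particular correct for n = s * d. *)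
Theorem theorem3p7 (R : realType) :
  (exists c : R, 0 < c /\
     forall (s n d L : nat), (2 <= s)%N -> (0 < d)%N -> (s * d <= n)%N ->
     forall P : coord_protocol s (local_system d),
       coord_tests_feasibility R n L P ->
       coord_complexity_ge n L P (c * (s * d ^ 2 * L)%:R))
  /\
  (exists c : R, 0 < c /\
     forall (s n d L : nat), (2 <= s)%N -> (0 < d)%N -> (s * d <= n)%N ->
     forall P : board_protocol s (local_system d),
       board_tests_feasibility R n L P ->
       board_complexity_ge n L P (c * (s + d ^ 2 * L)%:R)).
Proof.
split.
  exists 24%:R^-1; split=> [|s n d L s2 d0 sdn P test]; first by rewrite invr_gt0 ltr0n.
  have [S [bS [w [o [hw le]]]]] := coord_lower_bound s2 d0 sdn test.
  exists S; split=> //; exists w, o; split=> //.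
  by rewrite mulrC ler_pdivrMr ?ltr0n // -natrM ler_nat (mulnC (size w)).
exists 16%:R^-1; split=> [|s n d L s2 d0 sdn P test]; first by rewrite invr_gt0 ltr0n.
(* The sum is at most twice its larger term, hence [16 = 2 * 8]. *)
have [sL|Ls] := leqP s (d ^ 2 * L).
  have [S [bS [w [o [hw le]]]]] := board_lower_bound_family s2 d0 sdn test.
  exists S; split=> //; exists w, o; split=> //.
  by rewrite mulrC ler_pdivrMr ?ltr0n // -natrM ler_nat; lia.
have [S [bS [w [o [hw le]]]]] := board_lower_bound_servers s2 d0 sdn test.
exists S; split=> //; exists w, o; split=> //.
by rewrite mulrC ler_pdivrMr ?ltr0n // -natrM ler_nat; lia.
Qed.
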